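(* Consider the file-bundle caching problem with a single cache of size $k$ and queries of length $l$ (with $1\le l\le k$), as defined in the context. (i) No deterministic online algorithm for the file-bundle caching problem can achieve a competitive ratio better than $k-l+1$. (ii) The LRU algorithm has a competitive ratio of $k$; that is, there is a constant $c$ independent of $\sigma$ such that for every query sequence $\sigma$, $\mathrm{LRU}(\sigma)\le k\cdot \mathrm{OPT}(\sigma)+c$.
   Context: File-bundle caching problem: there is a set of pages $\mathcal{O}=\{1,\dots,N\}$ (with $N$ large compared to $k$), each of unit size, and a single cache of size $k$ whose content at time $t=1,2,\dots,T$ is $C_t\subset\mathcal{O}$ with $|C_t|=k$. At each time $t$ a query $Q_t\subset\mathcal{O}$ with $|Q_t|=l$ arrives and must be answered immediately by $C_t$. The cost at time $t$ is $f(C_t,Q_t)=\mathbb{1}_{\{Q_t\not\subseteq C_t\}}$ (a cache miss occurs if at least one page of the query is not in the cache). Upon a cache miss, the algorithm must update the cache to $C_{t+1}$ by inserting the pages of $Q_t$ and evicting some current pages, before $Q_{t+1}$ arrives; no other changes to the cache are allowed. An online algorithm makes its decisions without knowledge of future queries; the optimal offline algorithm $\mathrm{OPT}$ (with a cache of size $k$) knows the whole sequence. For a sequence $\sigma=\{Q_t\}_{t=1}^T$, $\mathrm{ALG}(\sigma)=\sum_t f(C_t,Q_t)$. An algorithm has competitive ratio $r$ if for every sequence $\sigma$, $\mathrm{ALG}(\sigma)\le r\cdot\mathrm{OPT}(\sigma)+c$ with $c$ a constant independent of $\sigma$. LRU (least recently used): whenever requested pages are not in the cache, they are put into the cache, evicting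 the least recently used pages (the pages whose most recent request was earliest). *)

(* Defs.v *)
From mathcomp Require Import all_boot all_order all_algebra.
From mathcomp Require Import reals.

Set Implicit Arguments.
Unset Strict Implicit.
Unset Printing Implicit Defensive.

Import Order.TTheory GRing.Theory Num.Theory.

Section Caching.

Variables (N k l : nat).

(* Pages are 'I_N; both queries and cache contents are sets of pages. Times are
   numbered from 0: the query at time t of sigma is nth set0 sigma t. *)
Notation pages := {set 'I_N}.

Implicit Types (Q C D : pages) (sigma h : seq pages).

Definition valid_queries sigma : bool := all (fun Q => #|Q| == l) sigma.

Definition miss C Q : bool := ~~ (Q \subset C).

Definition transition C Q C' : bool :=
  if miss C Q then [&& Q \subset C', C' \subset C :|: Q & #|C'| == k]
  else C' == C.

(* C t is the cache that answers the query at time t. *)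
Definition feasible sigma (C : nat -> pages) : bool :=
  (#|C 0| == k) &&
  [forall t : 'I_(size sigma), transition (C t) (nth set0 sigma t) (C t.+1)].

Definition cost sigma (C : nat -> pages) : nat :=
  \sum_(t < size sigma) miss (C t) (nth set0 sigma t).

(* Least cost of a feasible schedule of sigma that starts from the cache D1.
   A cost never exceeds size sigma, so the default value of the minimum does
   not matter as soon as a feasible schedule exists. *)
Definition OPT D1 sigma : nat :=
  \big[minn/size sigma]_(S : {ffun 'I_(size sigma).+1 -> pages} |
      (S ord0 == D1) && feasible sigma (fun t => S (inord t)))
    cost sigma (fun t => S (inord t)).

(* A deterministic online algorithm maps the sequence of past queries to the
   current cache content; A [::] is its initial cache. *)
Definition run (A : seq pages -> pages) sigma : nat -> pages :=
  fun t => A (take t sigma).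

Definition online_algorithm (A : seq pages -> pages) : Prop :=
  forall sigma, valid_queries sigma -> feasible sigma (run A sigma).

Definition ALG (A : seq pages -> pages) sigma : nat := cost sigma (run A sigma).

Definition competitive_ratio (R : realType) D1 (A : seq pages -> pages) (r : R)
    : Prop :=
  exists c : R, forall sigma, valid_queries sigma ->
    ((ALG A sigma)%:R <= r * (OPT D1 sigma)%:R + c)%R.

(* 0 if p does not occur in the history h, and otherwise one plus the time of
   the most recent query of h that contains p. *)
Definition last_request h (p : 'I_N) : nat :=
  \max_(t < size h | p \in nth set0 h t) t.+1.

(* Pages of one query are requested simultaneously, and the pages of the initial
   cache may never have been requested: such ties may be broken in any way, so
   being LRU is a property of online algorithms. The current query Q counts as
   a use of its pages. *)
Definition is_LRU (A : seq pages -> pages) : Prop :=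
  online_algorithm A /\
  forall h Q, valid_queries (rcons h Q) -> miss (A h) Q ->
    forall p q, p \in A h :\: A (rcons h Q) -> q \in A h :&: A (rcons h Q) ->
      last_request (rcons h Q) p <= last_request (rcons h Q) q.

(* Tie-breaking is always possible: there is an LRU algorithm for each initial
   cache. *)
Lemma LRU_exists C1 : l <= k -> #|C1| = k ->
  exists A, is_LRU A /\ A [::] = C1.
Proof.
move=> lk hC1.
pose ge_lr h Q : rel 'I_N :=
  fun p q => last_request (rcons h Q) q <= last_request (rcons h Q) p.
pose keep h Q C := take (k - #|Q|) (sort (ge_lr h Q) (enum (C :\: Q))).
pose next h Q C := if miss C Q then Q :|: [set p in keep h Q C] else C.
pose fix st r := if r is Q :: r' then next (rev r') Q (st r') else C1.
pose A h := st (rev h).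
have Arc h Q : A (rcons h Q) = next h Q (A h).
  by rewrite /A rev_rcons /= revK.
have keepS h Q C p : p \in keep h Q C -> p \in C :\: Q.
  by move=> /mem_take; rewrite mem_sort mem_enum.
have keep_card h Q C : #|C| = k -> #|Q| = l -> #|Q :|: [set p in keep h Q C]| = k.
  move=> hC hQ.
  have dis : Q :&: [set p in keep h Q C] = set0.
    apply/setP=> p; rewrite !inE; apply/negP=> /andP[pQ /keepS].
    by rewrite !inE pQ.
  have kc : #|[set p in keep h Q C]| = k - l.
    rewrite cardsE (card_uniqP _); last by rewrite take_uniq // sort_uniq enum_uniq.
    rewrite size_take_min size_sort -cardE hQ; apply/minn_idPl.
    by rewrite cardsD hC leq_sub2l // -hQ subset_leq_card // subsetIr.
  by rewrite cardsU dis cards0 subn0 kc hQ subnKC.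
have A_card h : valid_queries h -> #|A h| = k.
  elim/last_ind: h => [|h Q IH] //; rewrite /valid_queries all_rcons Arc.
  move=> /andP[/eqP hQ /IH hA]; rewrite /next; case: ifP => _ //.
  exact: keep_card.
exists A; split=> //; split.
  move=> sigma vs; apply/andP; split; first by rewrite /run take0 A_card.
  apply/forallP=> t; rewrite /run (take_nth set0) // Arc /next /transition.
  set h := take t sigma; set Q := nth set0 sigma t.
  have vh : valid_queries h by apply/allP=> D /mem_take /(allP vs).
  have vQ : #|Q| = l by apply/eqP/(allP vs); rewrite mem_nth.
  case: (miss _ _) => //; apply/and3P; split; first exact: subsetUl.
    rewrite subUset subsetUr; apply/subsetP=> p; rewrite !inE => /keepS.
    by rewrite inE => /andP[_ ->].
  by rewrite keep_card ?A_card.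
move=> h Q _ mAQ p q; rewrite Arc /next mAQ !inE negb_or.
move=> /andP[/andP[pQ pk] pA] /andP[qA /orP[qQ|qk]].
  have le_max : last_request (rcons h Q) p <= (size h).+1.
    by apply/bigmax_leqP=> t _; rewrite -(size_rcons h Q).
  apply: leq_trans le_max _.
  have ht : size h < size (rcons h Q) by rewrite size_rcons.
  rewrite /last_request (bigD1 (Ordinal ht)) /= ?leq_maxl //.
  by rewrite nth_rcons ltnn eqxx.
set s := sort (ge_lr h Q) (enum (A h :\: Q)).
have ps : p \in drop (k - #|Q|) s.
  have : p \in s by rewrite mem_sort mem_enum !inE pQ.
  by rewrite -{1}(cat_take_drop (k - #|Q|) s) mem_cat (negPf pk).
have tr : transitive (ge_lr h Q) by move=> a b c /[swap]; exact: leq_trans.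
have : sorted (ge_lr h Q) s by apply: sort_sorted => a b; exact: leq_total.
rewrite (sorted_pairwise tr) -(cat_take_drop (k - #|Q|) s) pairwise_cat.
by case/and3P=> /allrelP leqp _ _; exact: leqp qk ps.
Qed.

End Caching.

Arguments OPT {N} k D1 sigma.
Arguments competitive_ratio {N} k l {R} D1 A r.
Arguments is_LRU {N} k l A.
Arguments online_algorithm {N} k l A.

(* Main.v *)
Require Import Defs.
From mathcomp Require Import all_boot all_order all_algebra.
From mathcomp Require Import reals.
From mathcomp Require Import zify lra.

Import Order.TTheory GRing.Theory Num.Theory.

(** (i) The adversary only uses a set [U] of [k + 1] pages containing the initial
    cache [D1]. In a phase of [k - l + 1] queries it always asks for a page of
    [U] missing from the online cache, padded with [l - 1] pages already used
    in the phase. The online algorithm misses every time, while a phase touches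
    at most [k] pages, so an offline schedule pays at most once per phase: at its
    first miss it evicts a page of [U] that the phase never uses.

    (ii) Cut the queries into maximal phases that touch at most [k] pages. LRU
    evicts no page already requested in the current phase, so each of its misses
    brings in a page that is new in the phase: at most [k] misses per phase. Any
    schedule holds the first query of a phase right after serving it, hence it
    misses before or at the first query of the next phase, because these queries
    together touch more than [k] pages. *)

(** * Minima and intermediate finite sets *)

Lemma bigmin_leq (I : eqType) (r : seq I) (P : pred I) (F : I -> nat) x j :
  j \in r -> P j -> \big[minn/x]_(i <- r | P i) F i <= F j.
Proof.
elim: r => // a r IH; rewrite inE big_cons => /predU1P[<- ->|jr Pj].
  exact: geq_minl.
by case: ifP => _; [apply: leq_trans (geq_minr _ _) _|]; exact: IH.
Qed.

Lemma exists_between_card (T : finType) (A B : {set T}) n :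
  A \subset B -> #|A| <= n <= #|B| ->
  exists C : {set T}, [/\ A \subset C, C \subset B & #|C| = n].
Proof.
move=> AB /andP[An nB]; pose e := take (n - #|A|) (enum (B :\: A)).
have eD x : x \in e -> x \in B :\: A by move=> /mem_take; rewrite mem_enum.
exists (A :|: [set x in e]); split; first exact: subsetUl.
  by rewrite subUset AB; apply/subsetP=> x; rewrite inE => /eD /setDP[].
rewrite cardsU (_ : A :&: _ = set0) ?cards0; last first.
  by apply/setP=> x; rewrite !inE; apply/negP=> /andP[xA /eD]; rewrite inE xA.
rewrite subn0 cardsE (card_uniqP _) ?take_uniq ?enum_uniq //.
have := subset_leq_card AB.
by rewrite size_take_min -cardE cardsDS //; lia.
Qed.

Section Schedules.

Set Implicit Arguments.
Unset Strict Implicit.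

Variables (N k l : nat).
Implicit Types (Q C D E W U : {set 'I_N}) (h tau : seq {set 'I_N}).
Implicit Types (A : seq {set 'I_N} -> {set 'I_N}) (S : nat -> {set 'I_N}).

(** * Runs and schedules extended by one query *)

Lemma valid_rcons h Q :
  valid_queries l (rcons h Q) = (#|Q| == l) && valid_queries l h.
Proof. exact: all_rcons. Qed.

Lemma cost_rcons h Q S :
  cost (rcons h Q) S = cost h S + miss (S (size h)) Q.
Proof.
rewrite /cost size_rcons big_ord_recr /= nth_rcons ltnn eqxx; congr (_ + _).
by apply: eq_bigr => t _; rewrite nth_rcons ltn_ord.
Qed.

Lemma feasible_rcons h Q S :
  feasible k (rcons h Q) S =
  feasible k h S && transition k (S (size h)) Q (S (size h).+1).
Proof.
rewrite /feasible -andbA; congr (_ && _); rewrite size_rcons.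
apply/forallP/andP => [fS|[/forallP fS tr] t].
  split; last by have := fS ord_max; rewrite /= nth_rcons ltnn eqxx.
  apply/forallP=> t; have := fS (widen_ord (leqnSn _) t).
  by rewrite /= nth_rcons ltn_ord.
have [lt|] := ltnP t (size h).
  by have := fS (Ordinal lt); rewrite /= nth_rcons lt.
have := ltn_ord t; rewrite ltnS => le ge.
have -> : nat_of_ord t = size h by apply/eqP; rewrite eqn_leq le ge.
by rewrite nth_rcons ltnn eqxx.
Qed.

Lemma eq_feasible h S S' :
  (forall t, t <= size h -> S t = S' t) -> feasible k h S = feasible k h S'.
Proof.
move=> eqS; rewrite /feasible eqS //; congr (_ && _).
by apply: eq_forallb => t; rewrite !eqS // ltnW.
Qed.

Lemma eq_cost h S S' :
  (forall t, t <= size h -> S t = S' t) -> cost h S = cost h S'.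
Proof. by move=> eqS; apply: eq_bigr => t _; rewrite eqS // ltnW. Qed.

Lemma ALG_rcons A h Q : ALG A (rcons h Q) = ALG A h + miss (A h) Q.
Proof.
rewrite /ALG cost_rcons /run -cats1 take_size_cat //; congr (_ + _).
by apply: eq_cost => t le; rewrite takel_cat.
Qed.

Lemma ALG_leq_size A h : ALG A h <= size h.
Proof.
by elim/last_ind: h => [|h Q IH];
  rewrite ?ALG_rcons ?size_rcons /ALG /cost ?big_ord0 // -addn1 leq_add // leq_b1.
Qed.

Lemma transition_card C Q C' : #|C| = k -> transition k C Q C' -> #|C'| = k.
Proof.
by move=> cC; rewrite /transition; case: ifP => _ => [/and3P[_ _ /eqP]|/eqP ->].
Qed.

Lemma transition_sub C Q C' : transition k C Q C' -> Q \subset C'.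
Proof.
by rewrite /transition /miss; case: ifP => [_ /and3P[]//|/negbFE QC /eqP ->].
Qed.

Lemma feasible_card h S : feasible k h S -> #|S (size h)| = k.
Proof.
elim/last_ind: h => [/andP[/eqP]//|h Q IH].
by rewrite feasible_rcons size_rcons => /andP[/IH cS]; exact: transition_card.
Qed.

Lemma online_card A h : online_algorithm k l A -> valid_queries l h -> #|A h| = k.
Proof. by move=> oA /oA /feasible_card; rewrite /run take_size. Qed.

(** Keeps only the final cache and the cost of a schedule, so that offline schedules can be grown
    query by query. *)
Definition reach D h E n :=
  exists S, [/\ S 0 = D, feasible k h S, S (size h) = E & cost h S = n].

Lemma reach_nil D : #|D| = k -> reach D [::] D 0.
Proof.
move=> cD; exists (fun=> D); split=> //; last by rewrite /cost big_ord0.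
by apply/andP; split; [apply/eqP | apply/forallP; case].
Qed.

Lemma reach_rcons D h E n Q E' :
  reach D h E n -> transition k E Q E' ->
  reach D (rcons h Q) E' (n + miss E Q).
Proof.
move=> [S [S0 fS Se cS]] tr.
pose S' t := if t <= size h then S t else E'.
have eqS t : t <= size h -> S' t = S t by rewrite /S' => ->.
exists S'; split; first by rewrite eqS.
- by rewrite feasible_rcons (eq_feasible eqS) fS eqS // Se /S' ltnn.
- by rewrite size_rcons /S' ltnn.
- by rewrite cost_rcons (eq_cost eqS) cS eqS // Se.
Qed.

Lemma reach_card D h E n : reach D h E n -> #|E| = k.
Proof. by move=> [S [_ /feasible_card cS <- _]]. Qed.

Lemma OPT_leq D h E n : reach D h E n -> OPT k D h <= n.
Proof.
move=> [S [S0 fS _ <-]].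
pose F := [ffun i : 'I_(size h).+1 => S i].
have eqS t : t <= size h -> F (inord t) = S t by move=> le; rewrite ffunE inordK.
rewrite -(eq_cost eqS) /OPT.
apply: (@bigmin_leq _ _ _ (fun G : {ffun _ -> _} => cost h (fun t => G (inord t))) _ F).
  exact: mem_index_enum.
by rewrite (eq_feasible eqS) fS andbT -S0 ffunE.
Qed.

(** * Recency of requests and the upper bound for LRU *)

Lemma last_request_leq h p : last_request h p <= size h.
Proof. by apply/bigmax_leqP=> t _. Qed.

Lemma last_request_rcons h Q p :
  last_request (rcons h Q) p =
  if p \in Q then (size h).+1 else last_request h p.
Proof.
rewrite /last_request size_rcons big_mkcond big_ord_recr /=.
rewrite nth_rcons ltnn eqxx.
have -> : \max_(t < size h) (if p \in nth set0 (rcons h Q) t then t.+1 else 0)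
          = last_request h p.
  rewrite /last_request [RHS]big_mkcond; apply: eq_bigr => t _.
  by rewrite nth_rcons ltn_ord.
by case: ifP; rewrite ?maxn0 // => _; apply/maxn_idPr/leqW/last_request_leq.
Qed.

(** The pages touched by a phase whose first query has time [s]: [last_request] is one plus a time,
    so the strict inequality includes time [s]. *)
Definition requested_since h s := [set p | s < last_request h p].

Lemma requested_since_rcons h Q s : s <= size h ->
  requested_since (rcons h Q) s = requested_since h s :|: Q.
Proof.
move=> sh; apply/setP=> p; rewrite !inE last_request_rcons.
by case: ifP => _; rewrite ?orbF ?orbT.
Qed.

Lemma requested_since_last h Q : requested_since (rcons h Q) (size h) = Q.
Proof.
rewrite requested_since_rcons //; apply/setUidPr/subsetP=> p.
by rewrite inE ltnNge last_request_leq.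
Qed.

(* If a page [p] of the phase were evicted, every kept page would be at least as
   recent, so the new cache and [p] would all lie among at most [k] pages. *)
Lemma LRU_keeps_phase A h Q s :
  is_LRU k l A -> valid_queries l (rcons h Q) -> s <= size h ->
  requested_since h s \subset A h -> #|requested_since h s :|: Q| <= k ->
  requested_since h s :|: Q \subset A (rcons h Q).
Proof.
move=> [oA lruA] vhQ sh WA cW.
have := oA _ vhQ; rewrite feasible_rcons /run -cats1 take_size_cat //.
rewrite -(size_rcons h Q) cats1 take_size => /andP[_ tr].
have QA := transition_sub tr.
rewrite subUset QA andbT.
have cA := online_card oA vhQ.
have [mQ|hitQ] := boolP (miss (A h) Q); last first.
  by move: tr; rewrite /transition (negPf hitQ) => /eqP ->.
apply/subsetP=> p pW; apply: contraT => pA.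
suff : p |: A (rcons h Q) \subset requested_since h s :|: Q.
  by move=> /subset_leq_card; rewrite cardsU1 pA cA => /leq_trans/(_ cW); rewrite ltnn.
rewrite subUset sub1set inE pW /=; apply/subsetP=> q qA.
have [qQ|qQ] := boolP (q \in Q); first by rewrite inE qQ orbT.
have qAh : q \in A h.
  move: tr; rewrite /transition mQ => /and3P[_ /subsetP/(_ q qA)].
  by rewrite inE (negPf qQ) orbF.
rewrite -requested_since_rcons // inE.
apply: leq_trans (lruA h Q vhQ mQ p q _ _).
- suff : p \in requested_since (rcons h Q) s by rewrite inE.
  by rewrite requested_since_rcons // inE pW.
- by rewrite inE pA (subsetP WA).
- by rewrite inE qAh.
Qed.

(* [s] is the start of the current phase; the two alternatives say whether the
   schedule [S] has yet to miss after the first query of the phase. *)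
Lemma LRU_amortized A h S : 0 < l -> l <= k ->
  is_LRU k l A -> valid_queries l h -> feasible k h S ->
  exists s, let W := requested_since h s in
    [/\ s <= size h, #|W| <= k, W \subset A h &
     (W \subset S (size h) /\ ALG A h <= k * cost h S + #|W|) \/
     ALG A h + k <= k * cost h S + #|W|].
Proof.
move=> l0 lk lruA; elim/last_ind: h => [|h Q IH].
  move=> _ _; exists 0 => /=.
  have -> : requested_since [::] 0 = set0.
    by apply/setP=> p; rewrite !inE /last_request big_ord0.
  rewrite cards0 !sub0set; split=> //; left; split=> //.
  by rewrite /ALG /cost big_ord0.
move=> vhQ; rewrite feasible_rcons => /andP[fS tr].
have := vhQ; rewrite valid_rcons => /andP[/eqP cQ vh].
have [s [sh cW WA amort]] := IH vh fS.
have QS := transition_sub tr.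
rewrite size_rcons ALG_rcons cost_rcons.
set W := requested_since h s in cW WA amort.
have hitS : ~~ miss (S (size h)) Q -> S (size h).+1 = S (size h).
  by move=> hit; move: tr; rewrite /transition (negPf hit) => /eqP.
have [cWQ|cWQ] := leqP #|W :|: Q| k.
  have WQA := LRU_keeps_phase lruA vhQ sh WA cWQ.
  exists s; rewrite requested_since_rcons // -/W; split=> //; first exact: leqW.
  (* As [W] lies in the LRU cache, a query that misses has a page outside [W]: growth of [W] pays
     for the miss. *)
  have missW : miss (A h) Q + #|W| <= #|W :|: Q|.
    have [mQ|_] := boolP (miss _ _); last by rewrite subset_leq_card ?subsetUl.
    apply: proper_card; rewrite properE subsetUl /=.
    apply: contra mQ; rewrite subUset subxx => QW.
    exact: subset_trans QW WA.
  move: hitS; case: (miss (S _) Q) => hitS; rewrite ?addn1 ?addn0 ?mulnS.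
    by right; case: amort => [[_]|]; lia.
  case: amort => [[WS le]|le]; last by right; lia.
  by left; split; [rewrite subUset QS hitS // WS | lia].
(* [Q] overflows the phase and opens a new one. The old phase contributes at most [k], and a miss on
   [Q] is paid by the [l] pages of the new one. *)
exists (size h) => /=; rewrite requested_since_last cQ; split=> //.
  have := @LRU_keeps_phase A h Q (size h) lruA vhQ (leqnn _).
  have -> : requested_since h (size h) = set0.
    by apply/setP=> p; rewrite !inE ltnNge last_request_leq.
  by rewrite set0U sub0set cQ; exact.
left; split=> //.
have := leq_b1 (miss (A h) Q).
case: amort => [[WS le]|le]; last by nia.
(* A hit would put the more than [k] pages of [W :|: Q] into one cache. *)
have -> : miss (S (size h)) Q.
  apply: contraTT cWQ => /negbNE QSh; rewrite -leqNgt -(feasible_card fS).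
  by rewrite subset_leq_card // subUset WS.
by rewrite addn1 mulnS; lia.
Qed.

Lemma LRU_leq_OPT A D h : 0 < l -> l <= k ->
  is_LRU k l A -> valid_queries l h -> ALG A h <= k * OPT k D h + k.
Proof.
move=> l0 lk lruA vh; rewrite /OPT.
apply: (big_ind (fun n => ALG A h <= k * n + k)).
(* The default value [size h] of the minimum is harmless, since [k] is positive. *)
- by have := ALG_leq_size A h; nia.
- by move=> m n; rewrite /minn; case: ifP.
move=> S /andP[_ fS].
have [s [_ cW _ amort]] := LRU_amortized l0 lk lruA vh fS.
by move: cW amort => /=; lia.
Qed.

(** * Lower bound by an adversary *)

(** [W] starts with [l - 1] padding pages and gains one page per query, so it still has only [k]
    pages after [k + 1 - l] queries. *)
Lemma adversary_phase A U h j :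
  0 < l -> j <= k.+1 - l -> l <= k -> #|U| = k.+1 ->
  online_algorithm k l A -> valid_queries l h ->
  exists tau W, [/\ valid_queries l (h ++ tau), ALG A (h ++ tau) = ALG A h + j,
    W \subset U, #|W| = l.-1 + j & all (fun Q => Q \subset W) tau].
Proof.
move=> l0 + lk cU oA vh; elim: j => [_|j IH jk].
  have [||W [_ WU cW]] := @exists_between_card _ set0 U l.-1.
  - exact: sub0set.
  - by rewrite cards0 cU; lia.
  by exists [::], W; rewrite cats0 !addn0 cW.
have [tau [W [vt At WU cW tW]]] := IH (ltnW jk).
have /subsetPn[p pU pA] : ~~ (U \subset A (h ++ tau)).
  by apply/negP=> /subset_leq_card; rewrite cU (online_card oA vt) ltnn.
(* If [p] is already in [W], some other page of [U] is added to keep the count exact. *)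
have [||W' [pW' W'U cW']] := @exists_between_card _ (p |: W) U (l.-1 + j.+1).
- by rewrite subUset sub1set pU.
- by rewrite cardsU1 cW cU; case: (p \notin W); lia.
have [pinW' WW'] : p \in W' /\ W \subset W'.
  by apply/andP; rewrite -sub1set -subUset.
have [||Q [pQ QW' cQ]] := @exists_between_card _ [set p] W' l.
- by rewrite sub1set.
- by rewrite cards1 cW'; lia.
exists (rcons tau Q), W'; split=> //.
- by rewrite -rcons_cat valid_rcons cQ eqxx.
- rewrite -rcons_cat ALG_rcons At.
  suff -> : miss (A (h ++ tau)) Q by rewrite addn1 addnS.
  by apply/negP=> /subsetP/(_ p); rewrite (negPf pA) -sub1set pQ => /(_ isT).
- rewrite all_rcons QW'; apply: sub_all tW => E EW; exact: subset_trans WW'.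
Qed.

(** The final disjunction is the invariant: either no miss has occurred yet, or the cache contains
    [W] and no further miss can occur. *)
Lemma offline_phase D U W h E n tau :
  #|U| = k.+1 -> W \subset U -> #|W| <= k -> all (fun Q => Q \subset W) tau ->
  reach D h E n -> E \subset U ->
  exists E' n', [/\ reach D (h ++ tau) E' n', E' \subset U, n' <= n.+1 &
    n' = n \/ W \subset E'].
Proof.
move=> cU WU cW + rE EU; elim/last_ind: tau => [_|tau Q IH].
  by exists E, n; rewrite cats0; split=> //; left.
rewrite all_rcons -rcons_cat => /andP[QW /IH [E' [n' [rE' E'U n'n st]]]].
have [mQ|hit] := boolP (miss E' Q); last first.
  exists E', n'; split=> //; have := reach_rcons rE' (Q := Q) (E' := E').
  by rewrite /transition (negPf hit) addn0 => /(_ (eqxx _)).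
have n'E : n' = n.
  by case: st => // WE; case/negP: mQ; exact: subset_trans QW WE.
have /subsetPn[y yU yW] : ~~ (U \subset W).
  by apply/negP=> /subset_leq_card; rewrite cU ltnNge cW.
have WUy : W \subset U :\ y.
  by apply/subsetP=> x xW; rewrite !inE (subsetP WU) // andbT; apply: contraNneq yW => <-.
exists (U :\ y), n'.+1; split; [| exact: subD1set | by rewrite n'E | by right].
have := reach_rcons rE' (Q := Q) (E' := U :\ y); rewrite mQ addn1; apply.
rewrite /transition mQ (subset_trans QW WUy) /=; apply/andP; split; last first.
  by have := cardsD1 y U; rewrite yU cU => -[/esym/eqP].
(* [E'] lacks just one page of [U], which the missed [Q] must contain; hence every page but [y] is
   available. *)
suff -> : E' :|: Q = U by exact: subD1set.
apply/eqP; rewrite eqEcard subUset E'U (subset_trans QW WU) /= cU.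
rewrite -(reach_card rE'); apply: proper_card; rewrite properE subsetUl /=.
by rewrite subUset subxx.
Qed.

Lemma adversary A D n : 0 < l -> l <= k -> k < N -> #|D| = k ->
  online_algorithm k l A ->
  exists sigma, [/\ valid_queries l sigma, ALG A sigma = n * (k.+1 - l) &
    OPT k D sigma <= n].
Proof.
move=> l0 lk kN cD oA.
have [||U [DU _ cU]] := @exists_between_card _ D [set: 'I_N] k.+1.
- exact: subsetT.
- by rewrite cardsT card_ord cD leqnSn.
suff [sigma [E [m [vs As rE _ mn]]]] : exists sigma E m,
    [/\ valid_queries l sigma, ALG A sigma = n * (k.+1 - l),
        reach D sigma E m, E \subset U & m <= n].
  by exists sigma; split=> //; exact: leq_trans (OPT_leq rE) mn.
elim: n => [|n [h [E [m [vh Ah rE EU mn]]]]].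
  exists [::], D, 0; split=> //; last exact: reach_nil.
  by rewrite /ALG /cost big_ord0.
have [tau [W [vt At WU cW tW]]] := adversary_phase l0 (leqnn _) lk cU oA vh.
have cWk : #|W| <= k by rewrite cW; lia.
have [E' [m' [rE' E'U m'm _]]] := offline_phase cU WU cWk tW rE EU.
exists (h ++ tau), E', m'; split=> //; first by rewrite At Ah mulSn addnC.
exact: leq_trans m'm _.
Qed.

End Schedules.

Theorem theorem3p1 (R : realType) (N k l : nat)
    (hl : (1 <= l)%N) (hlk : (l <= k)%N) (hkN : (k < N)%N)
    (D1 : {set 'I_N}) (hD1 : #|D1| = k) :
  (forall (A : seq {set 'I_N} -> {set 'I_N}) (r : R),
      online_algorithm k l A ->
      (r < k%:R - l%:R + 1)%R ->
      ~ competitive_ratio k l D1 A r)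
  /\
  (forall A : seq {set 'I_N} -> {set 'I_N},
      is_LRU k l A ->
      competitive_ratio k l D1 A (k%:R : R)).
Proof.
split=> [A r oA rlt [c comp]|A lruA]; last first.
  exists (k%:R)%R => sigma vs; rewrite -natrM -natrD ler_nat.
  exact: LRU_leq_OPT lruA vs.
(* [r] may be negative; a nonnegative ratio is needed to use the upper bound [n] on [OPT]. *)
pose r' := Num.max r 0%R.
have mE : ((k.+1 - l)%:R = k%:R - l%:R + 1 :> R)%R.
  by rewrite natrB ?leqW // -natr1; lra.
have r'lt : (r' < (k.+1 - l)%:R)%R.
  by rewrite gt_max mE rlt -mE ltr0n subn_gt0 ltnS.
have bound n : (n%:R * ((k.+1 - l)%:R - r') <= c)%R.
  have [sigma [vs As On]] := @adversary N k l A D1 n hl hlk hkN hD1 oA.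
  have := comp _ vs; rewrite As natrM => le.
  have leO : (r * (OPT k D1 sigma)%:R <= r' * n%:R)%R.
    apply: (@le_trans _ _ (r' * (OPT k D1 sigma)%:R)%R).
      by rewrite ler_wpM2r // le_max lexx.
    by rewrite ler_wpM2l ?ler_nat // le_max lexx orbT.
  lra.
have d0 : (0 < (k.+1 - l)%:R - r')%R by rewrite subr_gt0.
(* By the Archimedean property the linear growth in [n] exceeds [c]; the case of zero phases shows
   that [c] is nonnegative. *)
have := bound (Num.bound (c / ((k.+1 - l)%:R - r'))); apply/negP; rewrite -ltNge.
rewrite -ltr_pdivrMr //; apply: archi_boundP; apply: divr_ge0 (ltW d0).
by have := bound 0; rewrite mul0r.
Qed.
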